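(* For every natural number $n$, there exists a set $A$ of positive integers with $|A|=n$ such that the graph $G_\phi(A)$ has size $n$ (i.e. exactly $n$ edges).
   Context: $\phi$ denotes Euler's totient function, $\phi^0(n)=n$ and $\phi^i(n)=\phi(\phi^{i-1}(n))$. For a set $A$ of positive integers, $A_\phi=\{\phi^k(n): n\in A,\ k\ge 0\}$, and $G_\phi(A)$ is the simple graph with vertex set $A_\phi$ in which distinct vertices $r,s$ are adjacent iff $\phi(r)=s$ or $\phi(s)=r$. The size of a graph is its number of edges. *)

(* Defs.v *)
From mathcomp Require Import all_boot.
From mathcomp Require Import mathcomp_extra boolp classical_sets functions cardinality.

Set Implicit Arguments.
Unset Strict Implicit.
Unset Printing Implicit Defensive.

Local Open Scope classical_set_scope.

(* The vertex set may be infinite; [adj] only relates vertices. *)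
Record simple_graph (T : Type) := SimpleGraph {
  vertices : set T;
  adj : T -> T -> Prop;
  adj_vertex : forall r s, adj r s -> vertices r /\ vertices s;
  adj_sym : forall r s, adj r s -> adj s r;
  adj_irrefl : forall r, ~ adj r r
}.

(* An edge is the unordered pair of two adjacent vertices. *)
Definition edges (T : Type) (G : simple_graph T) : set (set T) :=
  [set e | exists r s, adj G r s /\ e = [set r; s]].

Definition has_size (T : Type) (G : simple_graph T) (m : nat) : Prop :=
  (edges G #= `I_m)%card.

Definition phi_orbit (A : set nat) : set nat :=
  [set m | exists n k, A n /\ m = iter k totient n].

Definition phi_adj (A : set nat) (r s : nat) : Prop :=
  [/\ phi_orbit A r, phi_orbit A s, r <> s & totient r = s \/ totient s = r].

Fact phi_adj_vertex A r s : phi_adj A r s -> phi_orbit A r /\ phi_orbit A s.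
Proof. by case. Qed.

Fact phi_adj_sym A r s : phi_adj A r s -> phi_adj A s r.
Proof. by case=> Ar As /nesym rs [] e; split=> //; [right | left]. Qed.

Fact phi_adj_irrefl A r : ~ phi_adj A r r.
Proof. by case. Qed.

Definition phi_graph (A : set nat) : simple_graph nat :=
  SimpleGraph (@phi_adj_vertex A) (@phi_adj_sym A) (@phi_adj_irrefl A).

(* Main.v *)
Require Import Defs.
From mathcomp Require Import all_boot.
From mathcomp Require Import mathcomp_extra boolp classical_sets functions cardinality.
From mathcomp Require Import zify.

(* Take A = {2, 4, ..., 2^n}.  Since phi(2^(i+1)) = 2^i and phi(1) = 1, the
   graph of A is the path 1 - 2 - 4 - ... - 2^n, which has n edges. *)

(** Both counts are n by injectivity: [exp2_inj] for the elements of A, [exp2_pair_inj] for the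
    edges, which [edges_phi_exp2] identifies as the pairs of consecutive powers. *)

Local Open Scope classical_set_scope.

(* The truncated predecessor covers the fixed point [totient 1 = 1]. *)
Lemma totient_exp2 i : totient (2 ^ i) = 2 ^ i.-1.
Proof. by case: i => // i; rewrite totient_pfactor // mul1n. Qed.

Lemma iter_totient_exp2 k i : iter k totient (2 ^ i) = 2 ^ (i - k).
Proof. by elim: k => [|k IHk]; rewrite ?subn0 // iterS IHk totient_exp2 subnS. Qed.

Lemma exp2_inj : injective (expn 2).
Proof. by move=> i j /eqP; rewrite eqn_exp2l // => /eqP. Qed.

(** Since 2^(i+1) lies in the pair of j, i+1 is j+1 or j, so i <= j; symmetry gives equality. *)
Lemma exp2_pair_inj : injective (fun i => [set 2 ^ i.+1; 2 ^ i]).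
Proof.
have sub i j : [set 2 ^ i.+1; 2 ^ i] = [set 2 ^ j.+1; 2 ^ j] -> i <= j.
  move=> eij; have : [set 2 ^ j.+1; 2 ^ j] (2 ^ i.+1) by rewrite -eij; left.
  by case=> /exp2_inj; lia.
by move=> i j eij; apply/eqP; rewrite eqn_leq !sub.
Qed.

(** Equality fails for n = 0: the orbit is then empty, while the right side is {1}. *)
Lemma phi_orbit_exp2 n :
  phi_orbit [set 2 ^ i.+1 | i in `I_n] `<=` [set 2 ^ i | i in `I_n.+1].
Proof.
move=> _ [_ [k [[i /= lt_in <-] ->]]].
by exists (i.+1 - k); rewrite ?iter_totient_exp2 //=; lia.
Qed.

Lemma edges_phi_exp2 n :
  edges (phi_graph [set 2 ^ i.+1 | i in `I_n]) =
  [set [set 2 ^ i.+1; 2 ^ i] | i in `I_n].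
Proof.
apply/seteqP; split=> [e|_ [i /= lt_in <-]].
  have edge r s : phi_orbit [set 2 ^ i.+1 | i in `I_n] r -> r <> s ->
      totient r = s -> [set [set 2 ^ i.+1; 2 ^ i] | i in `I_n] [set r; s].
    move=> /phi_orbit_exp2[i /= lt_in <-]; rewrite totient_exp2.
    (* For i = 0, [r] is 1, which [totient] fixes, so [s] would equal [r]. *)
    case: i lt_in => [|i] lt_in neq_s def_s; [by case: neq_s | by exists i; rewrite -?def_s].
  case=> r [s [[/= Or Os neq_rs [] tot] ->]]; first exact: edge.
  by rewrite setUC; apply: edge => // /esym.
exists (2 ^ i.+1), (2 ^ i); split=> //; split.
- by exists (2 ^ i.+1), 0; split=> //; exists i.
(* Reaching 2^i from 2^(i+1) also covers the vertex 1, which is not in A. *)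
- by exists (2 ^ i.+1), 1; split; [exists i | rewrite /= totient_exp2].
- by move/exp2_inj; lia.
- by left; rewrite totient_exp2.
Qed.

Theorem theorem2p6 (n : nat) :
  exists A : set nat,
    [/\ forall a, A a -> (0 < a)%N,
        (A #= `I_n)%card
      & has_size (phi_graph A) n].
Proof.
exists [set 2 ^ i.+1 | i in `I_n]; split.
- by move=> _ [i _ <-]; rewrite expn_gt0.
- by apply: inj_card_eq => i j _ _ /exp2_inj[].
- rewrite /has_size edges_phi_exp2.
  by apply: inj_card_eq => i j _ _; apply: exp2_pair_inj.
Qed.
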